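(* Let $I\subset\mathbb{R}$ be an interval and let $\gamma(s)=\alpha(s)+\varepsilon\beta(s)$, $s\in I$, be a smooth curve in $\mathbb{D}^2$ parametrized by equiaffine arc-length. Let $\kappa_\gamma$ and $\kappa_\alpha$ denote the equiaffine curvatures of $\gamma$ and of its real part $\alpha$, respectively. Then $\kappa_\gamma=\kappa_\alpha$ on $I$ if and only if $\beta'=x\alpha'+y\alpha''$, where $x,y:I\to\mathbb{R}$ are smooth functions satisfying the system of ODEs $$x=-\tfrac12 y',\qquad y'''+4\kappa_\alpha y'+2\kappa_\alpha' y=0 .$$
   Context: $\mathbb{D}=\{x+\varepsilon y: x,y\in\mathbb{R}\}$, with $\varepsilon^2=0$, $\varepsilon\ne 0$, is the commutative ring of dual numbers, and $\mathbb{D}^2$ is the free module of rank 2 over it. A smooth curve $\gamma:I\to\mathbb{D}^2$ of a real variable is written $\gamma=\alpha+\varepsilon\beta$ with $\alpha,\beta:I\to\mathbb{R}^2$ smooth (real and dual parts); derivatives are taken componentwise. For $u=(u_1,u_2),v=(v_1,v_2)$ in $\mathbb{R}^2$ or $\mathbb{D}^2$, $(u,v)=u_1v_2-u_2v_1$. The curve $\gamma$ is parametrized by equiaffine arc-length if $(\gamma'(s),\gamma''(s))=1$ for all $s\in I$; equivalently $(\alpha',\alpha'')=1$ and $(\alpha',\beta'')+(\beta',\alpha'')=0$ on $I$. The equiaffine curvature of $\gamma$ is the function $\kappa_\gamma=(\gamma'',\gamma'''):I\to\mathbb{D}$, and that of $\alpha$ is $\kappa_\alpha=(\alpha'',\alpha'''):I\to\mathbb{R}$.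 *)

(* Defs.v *)
From HB Require Import structures.
From mathcomp Require Import all_boot all_order all_algebra.
From mathcomp Require Import all_classical all_reals all_analysis.

Set Implicit Arguments.
Unset Strict Implicit.
Unset Printing Implicit Defensive.
Import Order.TTheory GRing.Theory Num.Theory.
Import numFieldNormedType.Exports.
Local Open Scope classical_set_scope.
Local Open Scope ring_scope.

(* [Dual x y] is the dual number x + eps y. A new record is used because the
   library equips R * R with the componentwise product. *)
Record dual (R : Type) := Dual { dre : R ; ddu : R }.

Definition dual_pair (R : Type) (z : dual R) : R * R := (dre z, ddu z).
Definition pair_dual (R : Type) (p : R * R) : dual R := Dual p.1 p.2.

Lemma dual_pairK (R : Type) : cancel (@dual_pair R) (@pair_dual R).
Proof. by case. Qed.

HB.instance Definition _ (R : choiceType) :=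
  Choice.copy (dual R) (can_type (@dual_pairK R)).

Section DualRing.
Variable R : comNzRingType.
Implicit Types u v w : dual R.

Definition dual_zero : dual R := Dual 0 0.
Definition dual_one : dual R := Dual 1 0.
Definition dual_opp u : dual R := Dual (- dre u) (- ddu u).
Definition dual_add u v : dual R := Dual (dre u + dre v) (ddu u + ddu v).
Definition dual_mul u v : dual R :=
  Dual (dre u * dre v) (dre u * ddu v + ddu u * dre v).

Lemma dual_addA : associative dual_add.
Proof. by move=> u v w; rewrite /dual_add /= !addrA. Qed.

Lemma dual_addC : commutative dual_add.
Proof. by move=> u v; congr Dual; rewrite addrC. Qed.

Lemma dual_add0 : left_id dual_zero dual_add.
Proof. by case=> x y; rewrite /dual_add /= !add0r. Qed.

Lemma dual_addN : left_inverse dual_zero dual_opp dual_add.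
Proof. by move=> u; rewrite /dual_add /= !addNr. Qed.

HB.instance Definition _ :=
  GRing.isZmodule.Build (dual R) dual_addA dual_addC dual_add0 dual_addN.

Lemma dual_mulA : associative dual_mul.
Proof.
by move=> u v w; rewrite /dual_mul /= !mulrDl !mulrDr !mulrA !addrA.
Qed.

Lemma dual_mulC : commutative dual_mul.
Proof.
by move=> u v; congr Dual; rewrite 1?addrC; do ?congr (_ + _); rewrite mulrC.
Qed.

Lemma dual_mul1 : left_id dual_one dual_mul.
Proof. by case=> x y; rewrite /dual_mul /= !mul1r mul0r addr0. Qed.

Lemma dual_mulDl : left_distributive dual_mul dual_add.
Proof.
by move=> u v w; rewrite /dual_mul /dual_add /= !mulrDl addrACA.
Qed.

Lemma dual_one_neq0 : dual_one != dual_zero.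
Proof. by apply/eqP => -[] /eqP; rewrite oner_eq0. Qed.

HB.instance Definition _ := GRing.Zmodule_isComNzRing.Build (dual R)
  dual_mulA dual_mulC dual_mul1 dual_mulDl dual_one_neq0.

Definition dreal (x : R) : dual R := Dual x 0.
Definition deps : dual R := Dual 0 1.

Lemma deps_sq : deps * deps = 0.
Proof. by congr Dual; rewrite /= ?mulr0 ?mul0r ?addr0. Qed.

Lemma dualE (x y : R) : Dual x y = dreal x + deps * dreal y.
Proof. by congr Dual; rewrite /= ?mul0r ?mul1r ?add0r ?addr0. Qed.

End DualRing.

Arguments deps {R}.

Definition bracket (K : comNzRingType) (u v : 'rV[K]_2) : K :=
  u 0 0 * v 0 1 - u 0 1 * v 0 0.

Section Calculus.
Variables (R : realType) (I : set R).

(* The increment h is restricted to s + h in I: at an endpoint belonging to I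
   this gives the one-sided derivative, at an interior point the usual one. The
   values of f outside I are irrelevant. *)
Definition diffq_on (f : R -> R) (s : R) : set_system R :=
  h^-1 * (f (h + s) - f s) @[h --> within [set h | I (h + s)] 0^'].

Definition derivable_on (f : R -> R) (s : R) : Prop := cvg (diffq_on f s).

Definition derive_on (f : R -> R) (s : R) : R := lim (diffq_on f s).

Definition deriven_on (n : nat) (f : R -> R) : R -> R := iter n derive_on f.

Definition smooth_on (f : R -> R) : Prop :=
  forall n s, I s -> derivable_on (deriven_on n f) s.

Lemma within_shift_interior (s : R) : I° s ->
  within [set h | I (h + s)] (0 : R)^' = (0 : R)^'.
Proof.
move=> Is; apply/seteqP; split=> P; last by rewrite /within /=; apply: filterS.
have nI : \forall h \near (0 : R)^', I (h + s).
  apply: nbhs_dnbhs; have : \forall x \near s, I x by [].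
  by rewrite (near_shift 0) subr0.
by move=> PI; apply: filterS2 nI PI => h Ih; exact.
Qed.

Lemma derive_on_interior (f : R -> R) (s : R) : I° s ->
  derive_on f s = f^`()%classic s.
Proof. by move=> Is; rewrite /derive_on /diffq_on within_shift_interior. Qed.

Lemma derivable_on_interior (f : R -> R) (s : R) : I° s ->
  derivable_on f s <-> derivable f s 1.
Proof.
move=> Is; rewrite /derivable_on /diffq_on within_shift_interior //.
rewrite /derivable; have -> // :
  (fun h : R => h^-1 *: ((f \o shift s) (h *: 1) - f s)) =
  (fun h => h^-1 * (f (h + s) - f s)).
by apply/funext => h /=; rewrite [h *: 1]mulr1.
Qed.

Definition curve_derive (n : nat) (c : R -> 'rV[R]_2) (s : R) : 'rV[R]_2 :=
  \row_j deriven_on n (fun t => c t 0 j) s.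

Definition dcurve_derive (n : nat) (c : R -> 'rV[dual R]_2) (s : R) :
    'rV[dual R]_2 :=
  \row_j Dual (deriven_on n (fun t => dre (c t 0 j)) s)
              (deriven_on n (fun t => ddu (c t 0 j)) s).

Definition smooth_dcurve (c : R -> 'rV[dual R]_2) : Prop :=
  forall j, smooth_on (fun t => dre (c t 0 j)) /\
            smooth_on (fun t => ddu (c t 0 j)).

Definition equiaffine_arclength (c : R -> 'rV[dual R]_2) : Prop :=
  forall s, I s -> bracket (dcurve_derive 1 c s) (dcurve_derive 2 c s) = 1.

Definition curvature (c : R -> 'rV[R]_2) (s : R) : R :=
  bracket (curve_derive 2 c s) (curve_derive 3 c s).

Definition dcurvature (c : R -> 'rV[dual R]_2) (s : R) : dual R :=
  bracket (dcurve_derive 2 c s) (dcurve_derive 3 c s).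

End Calculus.

(* Main.v *)
Require Import Defs.
From HB Require Import structures.
From mathcomp Require Import all_boot all_order all_algebra.
From mathcomp Require Import all_classical all_reals all_analysis.
From mathcomp Require Import ring lra.
Import Order.TTheory GRing.Theory Num.Theory.
Import numFieldNormedType.Exports.
Local Open Scope classical_set_scope.
Local Open Scope ring_scope.

(** Write [[u, v]] for the bracket of two vectors and [a_k], [b_k] for the [k]-th
    derivatives of [alpha], [beta]. The real part of the arc-length condition is
    [[a_1, a_2] = 1], so [(a_1, a_2)] is a moving frame in which
    [b_1 = - [a_2, b_1] a_1 + [a_1, b_1] a_2] by Cramer's rule
    (lemma [frame_decomposition]). The coefficients [x] and [y] of the theorem
    are therefore forced: [y = [a_1, b_1]] and [x = - [a_2, b_1]]. They are
    smooth, being polynomial in derivatives of smooth functions.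

    The dual part of the arc-length condition, [[a_1, b_2] = [a_2, b_1]], gives
    [y' = [a_2, b_1] + [a_1, b_2] = 2 [a_2, b_1] = - 2 x]
    (lemma [derive_coefficient]). Hence both the decomposition of [b_1] and the
    relation between [x] and [y'] hold for every curve parametrized by arc
    length, and the only actual condition is the third-order equation.

    Differentiating [y' = 2 [a_2, b_1]] twice yields
    [y''' = 2 ([a_4, b_1] + 2 [a_3, b_2] + [a_2, b_3])]. Differentiating
    [[a_1, a_2] = 1] gives the structure equations [a_3 = - k a_1] and
    [a_4 = - k' a_1 - k a_2], where [k] is the curvature of [alpha]. Substituting
    these, every term cancels but one, and
    [y''' + 4 k y' + 2 k' y = 2 ([a_2, b_3] + [b_2, a_3])]
    (lemma [coefficient_ode]). The parenthesis on the right is the dual part of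
    the curvature of [gamma], whose real part is [k]; so the differential
    equation says exactly that the two curvatures agree.

    Derivatives are taken relative to the interval, one-sided at its endpoints,
    so the rules of calculus are first derived for them. *)

(** * Differential calculus relative to a nondegenerate interval *)

Section RelativeCalculus.
Context {R : realType} {I : set R}.
Hypotheses (I_itv : is_interval I) (I_nondeg : I° !=set0).

Lemma itv_neighbor (s : R) : exists2 t, I t & t != s.
Proof using I_nondeg.
have [c /= Ic] := I_nondeg.
have [e /= e0 ballI] := (@nbhs_ballP R R c I).1 Ic.
have Icc : I c by apply: ballI; exact: ballxx.
have [->|cs] := eqVneq s c; last by exists c => //; rewrite eq_sym.
exists (c + e / 2); last by apply/eqP; lra.
by apply: ballI; rewrite /ball /= opprD addNKr normrN gtr0_norm; lra.
Qed.

(** Limits of difference quotients are unique because [s] is an accumulation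
    point of [I]: the segment from [s] to any other point of [I] stays in [I]. *)
Lemma within_shift_proper (s : R) : I s ->
  ProperFilter (within [set h | I (h + s)] (0 : R)^').
Proof using I_itv I_nondeg.
move=> Is; split; last exact: within_filter.
rewrite /within /= /dnbhs /within /= => near_empty.
have [e /= e0 ballP] := (@nbhs_ballP R R _ _).1 near_empty.
have [t It ts] := itv_neighbor s.
have nts : 0 < `|t - s| by rewrite normr_gt0 subr_eq0.
(* The point at fraction [d] of the way from [s] to [t]: [d <= 1 / 2] keeps it
   in the segment, and the other bound keeps it within [e] of [s]. *)
pose d := Num.min (1 / 2) (e / 2 / `|t - s|).
have d0 : 0 < d.
  rewrite /d lt_min; apply/andP; split; first lra.
  by rewrite !divr_gt0.
have d1 : d <= 1 / 2 by rewrite /d ge_min lexx.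
have de : d * `|t - s| <= e / 2.
  by rewrite -ler_pdivlMr // /d ge_min lexx orbT.
apply: (ballP (d * (t - s))).
- by rewrite /ball /= sub0r normrN normrM (gtr0_norm d0); lra.
- by apply: mulf_neq0; [exact: lt0r_neq0|rewrite subr_eq0].
have [lts|] := ltP s t => [|les].
  apply: (I_itv s t Is It); apply/andP; split; nra.
apply: (I_itv t s It Is); apply/andP; split; nra.
Qed.

Definition has_derivative (f : R -> R) (s l : R) : Prop :=
  diffq_on I f s --> l.

Lemma has_derivativeE (f : R -> R) (s l : R) : I s ->
  has_derivative f s l -> derive_on I f s = l.
Proof using I_itv I_nondeg.
move=> Is fl; have := within_shift_proper s Is => PF.
by apply: cvg_lim fl.
Qed.

Lemma has_derivative_derivable (f : R -> R) (s l : R) :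
  has_derivative f s l -> derivable_on I f s.
Proof. by move=> fl; apply/cvg_ex; exists l. Qed.

(** Since [s] and all increments stay in [I], equality on [I] suffices. It is
    stated for the filters themselves, without assuming a limit, so that it
    transfers the value of [derive_on] and derivability alike. *)
Lemma diffq_on_ext (f g : R -> R) (s : R) : I s ->
  (forall t, I t -> f t = g t) -> diffq_on I f s = diffq_on I g s.
Proof.
(* By symmetry only one of the two inclusions of filters is proved. *)
have half (u v : R -> R) : I s -> (forall t, I t -> u t = v t) ->
    diffq_on I u s --> diffq_on I v s.
  move=> Is uv; apply: near_eq_cvg; rewrite near_withinE.
  by apply: nearW => h Ih; rewrite !uv.
by move=> Is fg; apply/seteqP; split; apply: half => // t /fg.
Qed.

Lemma has_derivative_cst (c s : R) : has_derivative (fun=> c) s 0.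
Proof.
rewrite /has_derivative /diffq_on.
under eq_fun do rewrite subrr mulr0.
exact: cvg_cst.
Qed.

Lemma has_derivativeD (f g : R -> R) (s l m : R) :
  has_derivative f s l -> has_derivative g s m ->
  has_derivative (fun t => f t + g t) s (l + m).
Proof.
move=> fl gm; rewrite /has_derivative /diffq_on.
under eq_fun do rewrite opprD addrACA mulrDr.
exact: cvgD fl gm.
Qed.

(** Off [0] the increment of [f] is [h] times the difference quotient, a product
    of functions tending to [0] and to [l]. *)
Lemma has_derivative_continuous (f : R -> R) (s l : R) :
  has_derivative f s l ->
  f (h + s) @[h --> within [set h | I (h + s)] 0^'] --> f s.
Proof.
move=> fl.
have h0 : h @[h --> within [set h | I (h + s)] (0 : R)^'] --> (0 : R).
  by move=> P P0; apply: filterS (nbhs_dnbhs P0).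
have fsc : f s @[_ --> within [set h | I (h + s)] (0 : R)^'] --> f s.
  exact: cvg_cst.
have := cvgD (cvgM h0 fl) fsc.
move=> /(_ _ _); rewrite mul0r add0r; apply: cvg_trans; apply: near_eq_cvg.
rewrite !near_withinE.
apply: nearW => h hn0 _.
rewrite -[LHS]/(h * (h^-1 * (f (h + s) - f s)) + f s).
by rewrite mulrA divff // mul1r subrK.
Qed.

(** The difference quotient of [f * g] is that of [f] times [g s], plus
    [f (h + s)] times that of [g]; the second term needs the continuity of [f]. *)
Lemma has_derivativeM (f g : R -> R) (s l m : R) :
  has_derivative f s l -> has_derivative g s m ->
  has_derivative (fun t => f t * g t) s (l * g s + f s * m).
Proof.
move=> fl gm; have fc := has_derivative_continuous _ _ _ fl.
have gsc : g s @[_ --> within [set h | I (h + s)] (0 : R)^'] --> g s.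
  exact: cvg_cst.
have := cvgD (cvgM fl gsc) (cvgM fc gm).
move=> /(_ _ _ _); rewrite /has_derivative /diffq_on.
apply: cvg_trans; apply: near_eq_cvg.
rewrite !near_withinE; apply: nearW => h _ _.
rewrite -[LHS]/(h^-1 * (f (h + s) - f s) * g s
  + f (h + s) * (h^-1 * (g (h + s) - g s))); ring.
Qed.

Lemma derive_on_ext (f g : R -> R) (s : R) : I s ->
  (forall t, I t -> f t = g t) -> derive_on I f s = derive_on I g s.
Proof. by move=> Is fg; rewrite /derive_on (diffq_on_ext f g). Qed.

Lemma derivable_on_ext (f g : R -> R) (s : R) : I s ->
  (forall t, I t -> f t = g t) -> derivable_on I f s -> derivable_on I g s.
Proof. by move=> Is fg; rewrite /derivable_on (diffq_on_ext f g). Qed.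

Lemma deriven_on_ext (n : nat) (f g : R -> R) (s : R) : I s ->
  (forall t, I t -> f t = g t) -> deriven_on I n f s = deriven_on I n g s.
Proof.
move=> Is fg; elim: n s Is => [|n IHn] s Is; first exact: fg.
exact: derive_on_ext.
Qed.

(** * Closure properties of smooth functions *)

(** Counting derivatives from the innermost one makes induction on the order
    possible: the product rule expresses the first derivative of a product
    through products, but says nothing direct about the higher ones. *)
Fixpoint differentiable_upto (n : nat) (f : R -> R) : Prop :=
  if n is n'.+1 then
    (forall s, I s -> derivable_on I f s) /\
    differentiable_upto n' (derive_on I f)
  else True.

Lemma smooth_onP (f : R -> R) :
  smooth_on I f <-> forall n, differentiable_upto n f.
Proof.
have deriven_onSr n g : deriven_on I n (derive_on I g) = deriven_on I n.+1 g.
  by rewrite /deriven_on iterSr.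
split=> [+ n|fn n].
  elim: n f => [//|n IHn] f fs; split; first exact: (fs 0).
  by apply: IHn => k s Is; rewrite deriven_onSr; exact: (fs k.+1).
elim: n f fn => [|n IHn] f fn s Is; first exact: (fn 1).1.
by rewrite -deriven_onSr; apply: IHn => // k; exact: (fn k.+1).2.
Qed.

Lemma differentiable_upto_ext (n : nat) (f g : R -> R) :
  (forall t, I t -> f t = g t) ->
  differentiable_upto n f -> differentiable_upto n g.
Proof.
elim: n f g => [//|n IHn] f g fg [f1 fn]; split=> [s Is|].
  exact: (derivable_on_ext f g s Is fg (f1 s Is)).
by apply: IHn fn => t It; exact: derive_on_ext.
Qed.

Lemma differentiable_uptoW (n : nat) (f : R -> R) :
  differentiable_upto n.+1 f -> differentiable_upto n f.
Proof. by elim: n f => [//|n IHn] f [f1 /IHn]. Qed.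

Lemma derive_onD (f g : R -> R) (s : R) : I s ->
  derivable_on I f s -> derivable_on I g s ->
  derive_on I (fun t => f t + g t) s = derive_on I f s + derive_on I g s.
Proof using I_itv I_nondeg.
move=> Is fs gs; apply: has_derivativeE => //; exact: has_derivativeD.
Qed.

Lemma derive_onM (f g : R -> R) (s : R) : I s ->
  derivable_on I f s -> derivable_on I g s ->
  derive_on I (fun t => f t * g t) s =
    derive_on I f s * g s + f s * derive_on I g s.
Proof using I_itv I_nondeg.
move=> Is fs gs; apply: has_derivativeE => //; exact: has_derivativeM.
Qed.

Lemma derive_on_cst (c s : R) : I s -> derive_on I (fun=> c) s = 0.
Proof using I_itv I_nondeg.
by move=> Is; apply: has_derivativeE => //; exact: has_derivative_cst.
Qed.

Lemma differentiable_uptoD (n : nat) (f g : R -> R) :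
  differentiable_upto n f -> differentiable_upto n g ->
  differentiable_upto n (fun t => f t + g t).
Proof using I_itv I_nondeg.
elim: n f g => [//|n IHn] f g [f1 fn] [g1 gn]; split=> [s Is|].
  apply: has_derivative_derivable; apply: has_derivativeD; [exact: f1|exact: g1].
apply: differentiable_upto_ext (IHn _ _ fn gn) => t It.
by rewrite derive_onD //; [exact: f1|exact: g1].
Qed.

Lemma differentiable_uptoM (n : nat) (f g : R -> R) :
  differentiable_upto n f -> differentiable_upto n g ->
  differentiable_upto n (fun t => f t * g t).
Proof using I_itv I_nondeg.
elim: n f g => [//|n IHn] f g fS gS.
have [[f1 fn] [g1 gn]] := (fS, gS); split=> [s Is|].
  apply: has_derivative_derivable; apply: has_derivativeM; [exact: f1|exact: g1].
apply: differentiable_upto_ext (differentiable_uptoD _ _ _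
  (IHn _ _ fn (differentiable_uptoW _ _ gS))
  (IHn _ _ (differentiable_uptoW _ _ fS) gn)) => t It.
by rewrite derive_onM //; [exact: f1|exact: g1].
Qed.

Lemma smooth_on_ext (f g : R -> R) :
  (forall t, I t -> f t = g t) -> smooth_on I f -> smooth_on I g.
Proof.
move=> fg /smooth_onP fs; apply/smooth_onP => n.
exact: differentiable_upto_ext fg (fs n).
Qed.

Lemma smooth_onD (f g : R -> R) : smooth_on I f -> smooth_on I g ->
  smooth_on I (fun t => f t + g t).
Proof using I_itv I_nondeg.
move=> /smooth_onP fs /smooth_onP gs; apply/smooth_onP => n.
exact: differentiable_uptoD.
Qed.

Lemma smooth_onM (f g : R -> R) : smooth_on I f -> smooth_on I g ->
  smooth_on I (fun t => f t * g t).
Proof using I_itv I_nondeg.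
move=> /smooth_onP fs /smooth_onP gs; apply/smooth_onP => n.
exact: differentiable_uptoM.
Qed.

Lemma smooth_on_cst (c : R) : smooth_on I (fun=> c).
Proof using I_itv I_nondeg.
apply/smooth_onP => n; elim: n c => [//|n IHn] c; split=> [s Is|].
  exact: has_derivative_derivable (has_derivative_cst c s).
by apply: differentiable_upto_ext (IHn 0) => t It; rewrite derive_on_cst.
Qed.

Lemma smooth_onZ (c : R) (f : R -> R) : smooth_on I f ->
  smooth_on I (fun t => c * f t).
Proof using I_itv I_nondeg.
by move=> fs; apply: smooth_onM => //; exact: smooth_on_cst.
Qed.

Lemma smooth_onB (f g : R -> R) : smooth_on I f -> smooth_on I g ->
  smooth_on I (fun t => f t - g t).
Proof using I_itv I_nondeg.
move=> fs gs; apply: smooth_on_ext (smooth_onD _ _ fs (smooth_onZ (-1) _ gs)).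
by move=> t _; rewrite mulN1r.
Qed.

Lemma smooth_on_deriven (n : nat) (f : R -> R) :
  smooth_on I f -> smooth_on I (deriven_on I n f).
Proof.
move=> fs k s Is; rewrite /deriven_on -iterD; exact: (fs (k + n)%N).
Qed.

Lemma derive_onZ (c : R) (f : R -> R) (s : R) : I s -> derivable_on I f s ->
  derive_on I (fun t => c * f t) s = c * derive_on I f s.
Proof using I_itv I_nondeg.
move=> Is fs; rewrite derive_onM ?derive_on_cst // ?mul0r ?add0r //.
exact: has_derivative_derivable (has_derivative_cst c s).
Qed.

Lemma derive_onB (f g : R -> R) (s : R) : I s ->
  derivable_on I f s -> derivable_on I g s ->
  derive_on I (fun t => f t - g t) s = derive_on I f s - derive_on I g s.
Proof using I_itv I_nondeg.
move=> Is fs gs; rewrite (@derive_on_ext _ (fun t => f t + -1 * g t)) //.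
  rewrite derive_onD ?derive_onZ ?mulN1r //.
  apply: has_derivative_derivable; apply: has_derivativeM gs.
  exact: has_derivative_cst.
by move=> t _; rewrite mulN1r.
Qed.

(** * Plane curves and their brackets *)

Definition smooth_curve (c : R -> 'rV[R]_2) : Prop :=
  forall j, smooth_on I (fun t => c t 0 j).

Definition curve_bracket (m n : nat) (u v : R -> 'rV[R]_2) (s : R) : R :=
  bracket (curve_derive I m u s) (curve_derive I n v s).

Lemma smooth_on_curve_bracket (m n : nat) (u v : R -> 'rV[R]_2) :
  smooth_curve u -> smooth_curve v -> smooth_on I (curve_bracket m n u v).
Proof using I_itv I_nondeg.
move=> us vs.
apply: (@smooth_on_ext (fun s =>
    deriven_on I m (fun t => u t 0 0) s * deriven_on I n (fun t => v t 0 1) s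
  - deriven_on I m (fun t => u t 0 1) s * deriven_on I n (fun t => v t 0 0) s)).
  by move=> s Is; rewrite /curve_bracket /bracket !mxE.
by apply: smooth_onB; apply: smooth_onM; exact: smooth_on_deriven.
Qed.

Lemma derive_on_curve_bracket (m n : nat) (u v : R -> 'rV[R]_2) (s : R) :
  smooth_curve u -> smooth_curve v -> I s ->
  derive_on I (curve_bracket m n u v) s =
    curve_bracket m.+1 n u v s + curve_bracket m n.+1 u v s.
Proof using I_itv I_nondeg.
move=> us vs Is.
have ud k j : derivable_on I (deriven_on I k (fun t => u t 0 j)) s by exact: us.
have vd k j : derivable_on I (deriven_on I k (fun t => v t 0 j)) s by exact: vs.
rewrite (@derive_on_ext _ (fun s =>
    deriven_on I m (fun t => u t 0 0) s * deriven_on I n (fun t => v t 0 1) s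
  - deriven_on I m (fun t => u t 0 1) s * deriven_on I n (fun t => v t 0 0) s)) //.
  rewrite derive_onB //; last 2 first.
  - by apply: has_derivative_derivable; apply: has_derivativeM; [exact: ud|exact: vd].
  - by apply: has_derivative_derivable; apply: has_derivativeM; [exact: ud|exact: vd].
  rewrite !derive_onM // /curve_bracket /bracket !mxE /deriven_on !iterS; ring.
by move=> t It; rewrite /curve_bracket /bracket !mxE.
Qed.

End RelativeCalculus.

Arguments smooth_curve {R} I c.
Arguments curve_bracket {R} I m n u v s.

(** * Algebra of the bracket *)

Section BracketAlgebra.
Context {R : comNzRingType}.
Implicit Types u v w : 'rV[R]_2.

Lemma bracketC u v : bracket u v = - bracket v u.
Proof. rewrite /bracket; ring. Qed.

Lemma bracketxx u : bracket u u = 0.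
Proof. rewrite /bracket; ring. Qed.

Lemma bracketDr u v w : bracket u (v + w) = bracket u v + bracket u w.
Proof. rewrite /bracket !mxE; ring. Qed.

Lemma bracketZr a u v : bracket u (a *: v) = a * bracket u v.
Proof. rewrite /bracket !mxE; ring. Qed.

Lemma bracketZl a u v : bracket (a *: u) v = a * bracket u v.
Proof. rewrite /bracket !mxE; ring. Qed.

Lemma bracketDl u v w : bracket (u + v) w = bracket u w + bracket v w.
Proof. rewrite /bracket !mxE; ring. Qed.

(** Cramer's rule for a frame of determinant one. *)
Lemma frame_decomposition u v w : bracket u v = 1 ->
  w = bracket w v *: u + bracket u w *: v.
Proof.
move=> uv1; rewrite -[LHS]scale1r -uv1; apply/rowP => j; rewrite !mxE /bracket.
case: (unliftP 0 j) => [k ->|->]; last by ring.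
have -> : lift 0 k = 1 by apply: val_inj; rewrite (ord1 k).
ring.
Qed.

(** The term [bracket u' v'] is lost because [eps] squares to zero. *)
Lemma bracket_dual u v u' v' :
  bracket (\row_j Dual (u 0 j) (u' 0 j)) (\row_j Dual (v 0 j) (v' 0 j)) =
  Dual (bracket u v) (bracket u v' + bracket u' v).
Proof. rewrite /bracket !mxE; congr Dual => /=; ring. Qed.

(** Pointwise algebra behind the differential equation. The vectors [u_i] and
    [v_i] stand for the [i]-th derivatives of [alpha] and [beta], the hypotheses
    for the arc-length conditions and their consequences, and the three summands
    on the left for [y'''], [4 k y'] and [2 k' y], where [k = [u2, u3]],
    [k' = [u2, u4]] and [y = [u1, v1]]. Eliminating [u3] and [u4] through the
    frame [(u1, u2)] leaves a multiple of the last hypothesis. *)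
Lemma curvature_ode_identity (u1 u2 u3 u4 v1 v2 v3 : 'rV[R]_2) :
  bracket u1 u2 = 1 -> bracket u1 u3 = 0 ->
  bracket u2 u3 + bracket u1 u4 = 0 ->
  bracket u1 v2 + bracket v1 u2 = 0 ->
  2 * (bracket u4 v1 + 2 * bracket u3 v2 + bracket u2 v3)
  + 4 * bracket u2 u3 * (2 * bracket u2 v1)
  + 2 * bracket u2 u4 * bracket u1 v1
  = 2 * (bracket u2 v3 + bracket v2 u3).
Proof.
move=> d12 d13 d14 dual_arclength.
have := frame_decomposition _ _ u3 d12; have := frame_decomposition _ _ u4 d12.
rewrite d13 scale0r addr0 -[bracket u1 u4](addKr (bracket u2 u3)) d14 addr0.
rewrite (bracketC u4) (bracketC u3 u2).
(* Now [u4 = - k' *: u1 - k *: u2] and [u3 = - k *: u1]; the coefficients, which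
   mention [u3] and [u4], are generalized to allow substitution. *)
move: (bracket u2 u3) (bracket u2 u4) => k k' -> ->.
rewrite !bracketDl !bracketZl bracketZr; apply: subr0_eq.
(* The two sides differ by [6 k [u2, v1] - 6 k [u1, v2]]. *)
rewrite -[RHS](mulr0 (- 6 * k)) -dual_arclength /bracket; ring.
Qed.

End BracketAlgebra.

(** * Curves parametrized by equiaffine arc length *)

Section EquiaffineCurves.
Context {R : realType} {I : set R}.
Hypotheses (I_itv : is_interval I) (I_nondeg : I° !=set0).
Variables (alpha beta : R -> 'rV[R]_2).
Hypotheses (alpha_smooth : smooth_curve I alpha)
  (beta_smooth : smooth_curve I beta).
Hypothesis alpha_arclength :
  forall s, I s -> curve_bracket I 1 2 alpha alpha s = 1.
Hypothesis dual_arclength : forall s, I s ->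
  curve_bracket I 1 2 alpha beta s + curve_bracket I 1 2 beta alpha s = 0.

Let D := derive_on I.
Notation aa m n := (curve_bracket I m n alpha alpha).
Notation ab m n := (curve_bracket I m n alpha beta).
Notation ba m n := (curve_bracket I m n beta alpha).

Lemma curve_bracketC m n (u v : R -> 'rV[R]_2) s :
  curve_bracket I m n u v s = - curve_bracket I n m v u s.
Proof. exact: bracketC. Qed.

Lemma curve_bracketxx m (u : R -> 'rV[R]_2) s :
  curve_bracket I m m u u s = 0.
Proof. exact: bracketxx. Qed.

(** Derivative of [[a_1, a_2] = 1]; together with the frame it says that [a_3] is
    proportional to [a_1]. *)
Lemma arclength_bracket13 s : I s -> aa 1 3 s = 0.
Proof using I_itv I_nondeg alpha_smooth alpha_arclength.
move=> Is; have := derive_on_curve_bracket I_itv I_nondeg 1 2 _ _ s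
  alpha_smooth alpha_smooth Is.
rewrite (derive_on_ext _ (fun=> 1) s Is alpha_arclength) derive_on_cst //.
by rewrite curve_bracketxx add0r.
Qed.

Lemma arclength_bracket23_14 s : I s -> aa 2 3 s + aa 1 4 s = 0.
Proof using I_itv I_nondeg alpha_smooth alpha_arclength.
move=> Is; rewrite -(derive_on_curve_bracket I_itv I_nondeg 1 3) //.
by rewrite (derive_on_ext _ (fun=> 0) s Is arclength_bracket13) derive_on_cst.
Qed.

(** The other term of the product rule, [[a_3, a_3]], vanishes. *)
Lemma derive_curvature s : I s -> D (curvature I alpha) s = aa 2 4 s.
Proof using I_itv I_nondeg alpha_smooth.
move=> Is; have := derive_on_curve_bracket I_itv I_nondeg 2 3 _ _ s
  alpha_smooth alpha_smooth Is.
by rewrite curve_bracketxx add0r.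
Qed.

(** The dual part of the arc-length condition makes the two terms of the product
    rule equal. *)
Lemma derive_coefficient s : I s -> D (ab 1 1) s = 2 * ab 2 1 s.
Proof using I_itv I_nondeg alpha_smooth beta_smooth dual_arclength.
move=> Is; rewrite /D derive_on_curve_bracket //.
have := dual_arclength s Is; rewrite (curve_bracketC 1 2 beta) => /subr0_eq ->.
by rewrite mulr_natl mulr2n.
Qed.

Lemma derive3_coefficient s : I s ->
  deriven_on I 3 (ab 1 1) s = 2 * (ab 4 1 s + 2 * ab 3 2 s + ab 2 3 s).
Proof using I_itv I_nondeg alpha_smooth beta_smooth dual_arclength.
move=> Is.
have dab m n t : I t -> derivable_on I (ab m n) t.
  by apply: (@smooth_on_curve_bracket _ _ I_itv I_nondeg _ _ _ _ _ _ 0).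
have D2 t : I t -> D (D (ab 1 1)) t = 2 * (ab 3 1 t + ab 2 2 t).
  move=> It; rewrite /D (derive_on_ext _ _ t It derive_coefficient).
  by rewrite derive_onZ ?derive_on_curve_bracket //; exact: dab.
rewrite /deriven_on /= (derive_on_ext _ _ s Is D2) derive_onZ //; last first.
  by apply: has_derivative_derivable; apply: has_derivativeD; exact: dab.
rewrite derive_onD ?derive_on_curve_bracket //; [ring|exact: dab..].
Qed.

(** The right-hand side is twice the dual part of the equiaffine curvature of
    [alpha + eps beta], so that the differential equation for [y] expresses the
    vanishing of that dual part. *)
Lemma coefficient_ode s : I s ->
  deriven_on I 3 (ab 1 1) s + 4 * curvature I alpha s * D (ab 1 1) s
  + 2 * D (curvature I alpha) s * ab 1 1 s
  = 2 * (ab 2 3 s + ba 2 3 s).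
Proof using I_itv I_nondeg alpha_smooth beta_smooth alpha_arclength
  dual_arclength.
move=> Is; rewrite derive3_coefficient // derive_coefficient //.
rewrite derive_curvature //; apply: curvature_ode_identity.
- exact: alpha_arclength.
- exact: arclength_bracket13.
- exact: arclength_bracket23_14.
- exact: dual_arclength.
Qed.

(** In the frame [(a_1, a_2)] the first coordinate of [b_1] is
    [[b_1, a_2] = - [a_2, b_1]], which is minus half the derivative of the second
    coordinate [[a_1, b_1]]. *)
Lemma derive_beta_decomposition s : I s ->
  curve_derive I 1 beta s =
    (- (1 / 2) * D (ab 1 1) s) *: curve_derive I 1 alpha s
    + ab 1 1 s *: curve_derive I 2 alpha s.
Proof using I_itv I_nondeg alpha_smooth beta_smooth alpha_arclength
  dual_arclength.
move=> Is; rewrite [LHS](frame_decomposition _ _ _ (alpha_arclength s Is)).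
rewrite derive_coefficient // (bracketC (curve_derive I 1 beta s)).
rewrite -/(curve_bracket I 2 1 alpha beta s) -/(curve_bracket I 1 1 alpha beta s).
by congr (_ *: _ + _); field.
Qed.

End EquiaffineCurves.

Theorem theorem3p6 (R : realType) (I : set R)
  (I_itv : is_interval I) (I_nondeg : I° !=set0)
  (gamma : R -> 'rV[dual R]_2) (alpha beta : R -> 'rV[R]_2)
  (gammaE : forall s, I s ->
     gamma s = map_mx (@dreal R) (alpha s) + deps *: map_mx (@dreal R) (beta s))
  (gamma_smooth : smooth_dcurve I gamma)
  (gamma_arclength : equiaffine_arclength I gamma) :
  (forall s, I s -> dcurvature I gamma s = dreal (curvature I alpha s)) <->
  (exists x y : R -> R,
    [/\ smooth_on I x,
        smooth_on I y,
        forall s, I s ->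
          curve_derive I 1 beta s =
            x s *: curve_derive I 1 alpha s + y s *: curve_derive I 2 alpha s,
        forall s, I s -> x s = - (1 / 2%:R) * derive_on I y s
      & forall s, I s ->
          deriven_on I 3 y s
          + 4%:R * curvature I alpha s * derive_on I y s
          + 2%:R * derive_on I (curvature I alpha) s * y s = 0]).
Proof.
have reE j t : I t -> dre (gamma t 0 j) = alpha t 0 j.
  by move=> It; rewrite gammaE // !mxE /= mul0r addr0.
have duE j t : I t -> ddu (gamma t 0 j) = beta t 0 j.
  by move=> It; rewrite gammaE // !mxE /= !mul0r mul1r !add0r.
have alpha_smooth : smooth_curve I alpha.
  by move=> j; apply: smooth_on_ext (gamma_smooth j).1; exact: reE.
have beta_smooth : smooth_curve I beta.
  by move=> j; apply: smooth_on_ext (gamma_smooth j).2; exact: duE.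
have dgammaE n s : I s -> dcurve_derive I n gamma s =
    \row_j Dual (curve_derive I n alpha s 0 j) (curve_derive I n beta s 0 j).
  move=> Is; apply/rowP => j; rewrite !mxE.
  by congr Dual; apply: deriven_on_ext => // t; [exact: reE|exact: duE].
have dbracketE m n s : I s ->
    bracket (dcurve_derive I m gamma s) (dcurve_derive I n gamma s) =
    Dual (curve_bracket I m n alpha alpha s)
      (curve_bracket I m n alpha beta s
       + curve_bracket I m n beta alpha s).
  by move=> Is; rewrite !dgammaE // bracket_dual.
have alpha_arclength s : I s -> curve_bracket I 1 2 alpha alpha s = 1.
  by move=> Is; have := gamma_arclength s Is; rewrite dbracketE // => -[].
have dual_arclength s : I s -> curve_bracket I 1 2 alpha beta s
    + curve_bracket I 1 2 beta alpha s = 0.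
  by move=> Is; have := gamma_arclength s Is; rewrite dbracketE // => -[].
pose y0 := curve_bracket I 1 1 alpha beta.
have ode s Is := coefficient_ode I_itv I_nondeg _ _ alpha_smooth beta_smooth
  alpha_arclength dual_arclength s Is.
split=> [kappaE|[x [y [_ _ betaE _ yode]]] s Is].
  have y0_smooth : smooth_on I y0 by exact: smooth_on_curve_bracket.
  exists (fun s => - (1 / 2) * derive_on I y0 s), y0; split => //.
  - by apply: smooth_onZ => //; exact: (smooth_on_deriven 1).
  - by move=> s Is; exact: derive_beta_decomposition.
  - move=> s Is; rewrite ode //.
    have := kappaE s Is; rewrite /dcurvature dbracketE // => -[->].
    by rewrite mulr0.
(* Pairing the decomposition of [b_1] with [a_1] isolates [y]. *)
have yE t : I t -> y t = y0 t.
  move=> It; rewrite /y0 /curve_bracket betaE // bracketDr !bracketZr.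
  by rewrite bracketxx [bracket _ _]alpha_arclength // mulr0 add0r mulr1.
rewrite /dcurvature dbracketE //; congr Dual.
apply: (@mulfI _ 2); first by rewrite pnatr_eq0.
rewrite mulr0 -ode // -(yode s Is) (deriven_on_ext 3 _ _ s Is yE).
by rewrite (derive_on_ext _ _ s Is yE) yE.
Qed.
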